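(* Let $k\ge 2$ be an integer. Then $|\mathcal E_{k,n}| = F_n$ if $1\le n\le 2k-2$, and $|\mathcal E_{k,2k-1}| = F_{2k-1}-1$. For every integer $n\ge 2k$, $$|\mathcal E_{k,n}| = |\mathcal E_{k,n-1}|+|\mathcal E_{k,n-3}|+\cdots+|\mathcal E_{k,n-(2k-1)}| = \sum_{i=1}^{k}|\mathcal E_{k,n-(2i-1)}|.$$
   Context: $\mathbb N=\{1,2,3,\dots\}$, $[n]=\{1,2,\dots,n\}$, and $[a,b]$ is the set of all integers between $a$ and $b$ inclusive. A finite nonempty set $F\subset\mathbb N$ is called Schreier if $\min F\ge |F|$. For $k\ge 2$ and $n\in\mathbb N$, $\mathcal E_{k,n}:=\{F\subset[n] : n\in F,\ F\text{ is Schreier, and } [m,m+k-1]\not\subset F \text{ for all } m\in F\}$. The numbers $F_n$ are the Fibonacci numbers: $F_1=F_2=1$ and $F_n=F_{n-1}+F_{n-2}$ for $n\ge 3$. *)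

(* Defs.v *)
From mathcomp Require Import all_boot finmap.

Set Implicit Arguments.
Unset Strict Implicit.
Unset Printing Implicit Defensive.

Local Open Scope fset_scope.

(* The positive integers are represented inside nat.  No positivity condition
   is needed on Schreier sets: if 0 \in F then fset_min F = 0 < #|` F|. *)

(* The extension fib 0 = 0 makes fib 1 = fib 2 = 1 and fib n = fib (n-1) + fib (n-2)
   for n >= 2. *)
Fixpoint fib (n : nat) : nat :=
  match n with
  | 0 => 0
  | 1 => 1
  | (m.+1 as p).+1 => fib p + fib m
  end.

Definition interval (a b : nat) : {fset nat} := [fset i in index_iota a b.+1].

Lemma in_interval (a b i : nat) : (i \in interval a b) = (a <= i <= b).
Proof. by rewrite /interval inE /= mem_index_iota ltnS. Qed.

(* Junk value 0 on the empty set. *)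
Definition fset_min (F : {fset nat}) : nat := head 0 (sort leq F).

Lemma fset_min_in (F : {fset nat}) : F != fset0 -> fset_min F \in F.
Proof.
move=> /fset0Pn [x xF].
rewrite /fset_min -[_ \in F](mem_sort leq).
have : x \in sort leq F by rewrite mem_sort.
by case: (sort leq F) => [|y s] //= _; rewrite mem_head.
Qed.

Lemma fset_min_le (F : {fset nat}) (x : nat) : x \in F -> fset_min F <= x.
Proof.
move=> xF; rewrite /fset_min.
have : x \in sort leq F by rewrite mem_sort.
have := sort_sorted leq_total F.
case: (sort leq F) => [|y s] //= /(order_path_min leq_trans) /allP ys.
by rewrite inE => /orP [/eqP -> //|/ys].
Qed.

Definition Schreier (F : {fset nat}) : bool :=
  (F != fset0) && (#|` F| <= fset_min F).

Definition calE (k n : nat) : {fset {fset nat}} :=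
  [fset F in fpowerset (interval 1 n) |
     [&& n \in F, Schreier F
       & all (fun m => ~~ (interval m (m + k - 1) `<=` F)) F]].

Lemma in_calE (k n : nat) (F : {fset nat}) :
  reflect [/\ F `<=` interval 1 n, n \in F, Schreier F &
           forall m, m \in F -> ~~ (interval m (m + k - 1) `<=` F)]
          (F \in calE k n).
Proof.
rewrite !inE /= fpowersetE.
apply: (iffP and4P) => [[-> -> -> /allP h]|[-> -> -> h]]; split=> //.
by apply/allP.
Qed.

(* Main.v *)
Require Import Defs.
From mathcomp Require Import all_boot zify finmap.

(** Let [x n] be the number of sets with maximum [n] having [n - 1] outside, and
    otherwise as in [calE k n].  A set whose final block of consecutive elements
    has length [j + 1 >= 2] arises uniquely from one with maximum [n - 2] and
    final block of length [j], by translating by 1 and adding [n]; this raises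
    both the cardinal and the minimum by 1, hence preserves the Schreier
    condition.  So there are [x (n - 2 j)] sets with final block [j + 1].  Moving
    the maximum from [n] to [n + 1] identifies the sets with final block of
    length between 1 and [k] with those counted by [x (n + 1)], whence
    [x (n + 1) = \sum_(i < k) x (n - 2 i)], while
    [#|` calE k n| = \sum_(i < k - 1) x (n - 2 i)]. *)

Local Open Scope fset_scope.

(** * Counting finite sets by bijections and by fibers *)

Lemma card_fset_bij {T U : choiceType} {A : {fset T}} {B : {fset U}}
    (f : T -> U) (g : U -> T) :
  (forall x, x \in A -> f x \in B) -> (forall y, y \in B -> g y \in A) ->
  {in A, cancel f g} -> {in B, cancel g f} -> #|` A| = #|` B|.
Proof.
move=> fAB gBA fK gK; have finj := can_in_inj fK; rewrite -(card_in_imfset imfset_key finj) /=.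
congr #|` _|; apply/fsetP => y; apply/imfsetP/idP => [[x /= xA ->]|yB].
  exact: fAB.
by exists (g y); rewrite /= ?gBA ?gK.
Qed.

Lemma in_fset_sep (T : choiceType) (A : {fset T}) (P : pred T) x :
  (x \in [fset y in A | P y]) = (x \in A) && P x.
Proof. by rewrite !inE. Qed.

Lemma card_fset_sum_fibers (T : choiceType) (A : {fset T}) (r : T -> nat) a b :
  (forall x, x \in A -> a <= r x < b) ->
  #|` A| = \sum_(a <= j < b) #|` [fset x in A | r x == j]|.
Proof.
move=> rA; have cardE (P : pred T) : #|` [fset x in A | P x]| = \sum_(x <- A | P x) 1.
  by rewrite card_fset_sum1 big_fset.
under eq_bigr => j _ do rewrite cardE.
rewrite (exchange_big_dep xpredT) //= card_fset_sum1 !big_seq.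
apply: eq_bigr => x xA; have rx := rA x xA.
rewrite sum1_count.
rewrite (eq_count (a2 := pred1 (r x))) => [|j]; last by rewrite /= eq_sym.
by rewrite count_uniq_mem ?iota_uniq // mem_index_iota rx.
Qed.

(** * The Schreier condition and runs of consecutive elements *)

Lemma SchreierP {F : {fset nat}} {n : nat} :
  n \in F -> reflect (forall m : nat, m \in F -> #|` F| <= m) (Schreier F).
Proof.
move=> nF; have F0 : F != fset0 by apply/fset0Pn; exists n.
rewrite /Schreier F0; apply: (iffP idP) => [Fm m mF|].
  exact: leq_trans Fm (fset_min_le mF).
by apply; apply: fset_min_in.
Qed.

(* The length of the block of consecutive positive elements of [F] ending at [n]. *)
Fixpoint run (F : {fset nat}) (n : nat) : nat :=
  if n is m.+1 then if n \in F then (run F m).+1 else 0 else 0.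

Lemma leq_runP (F : {fset nat}) n j :
  j <= run F n <-> j <= n /\ forall m, n - j < m <= n -> m \in F.
Proof.
elim: n j => [|n IH] [|j] /=.
- by split=> // _; split=> // m; lia.
- by split=> // -[].
- by split=> // _; split=> // m; lia.
split=> [|[jn jF]].
  case: ifP => // nF; rewrite ltnS => /IH [jn jF]; split=> // m mn.
  by have [->//|m_n] := eqVneq m n.+1; apply: jF; lia.
rewrite jF ?ltnS; last lia.
by apply/IH; split=> // m mn; apply: jF; lia.
Qed.

Lemma run_in (F : {fset nat}) n : n.+1 \in F -> run F n.+1 = (run F n).+1.
Proof. by move=> /= ->. Qed.

Lemma run_notin (F : {fset nat}) n : n \notin F -> run F n = 0.
Proof. by case: n => //= n /negPf->. Qed.

Lemma eq_run (F G : {fset nat}) n :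
  (forall m, m <= n -> (m \in F) = (m \in G)) -> run F n = run G n.
Proof.
elim: n => //= n IH FG; rewrite FG // IH // => m mn.
by apply: FG; apply: leqW.
Qed.

Lemma run_shift (F G : {fset nat}) n :
  1 \notin F -> (forall m, m <= n -> (m.+1 \in F) = (m \in G)) ->
  run F n.+1 = run G n.
Proof.
move=> F1; elim: n => [|n IH] FG; first by rewrite /= (negPf F1).
have /= IHn : run F n.+1 = run G n by apply: IH => m mn; apply/FG/leqW.
by rewrite /= FG // IHn.
Qed.

(** Runs ending before [n] must be shorter than [k], but the final one may have length [k]: this is
    exactly what results when an isolated maximum [n.+1] is moved down to [n]. *)
Definition pre_calE (k n : nat) : {fset {fset nat}} :=
  [fset F in fpowerset (interval 1 n) |
     [&& n \in F, Schreier F & all (fun i => run F i < k) (iota 0 n)]].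

Lemma in_pre_calE (k n : nat) (F : {fset nat}) :
  reflect [/\ n \in F, forall m : nat, m \in F -> #|` F| <= m <= n &
           forall i, i < n -> run F i < k]
          (F \in pre_calE k n).
Proof.
rewrite !inE /= fpowersetE; apply: (iffP idP).
  case/and4P => /fsubsetP Fn nF /(SchreierP nF) FS /allP Fk; split=> //.
    by move=> m mF; rewrite FS //; have := Fn m mF; rewrite in_interval => /andP[].
  by move=> i i_n; apply: Fk; rewrite mem_iota.
case=> nF Fn Fk; have /= F0 : 0 < #|` F| by rewrite cardfs_gt0; apply/fset0Pn; exists n.
rewrite nF /=; apply/and3P; split.
- by apply/fsubsetP => /= m mF; rewrite in_interval; have := Fn m mF; lia.
- by apply/(SchreierP nF) => m /Fn/andP[].
- by apply/allP => i; rewrite mem_iota => /andP[_ i_n]; apply: Fk.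
Qed.

Definition final_run (k n j : nat) : {fset {fset nat}} :=
  [fset F in pre_calE k n | run F n == j].

Lemma in_final_run k n j (F : {fset nat}) :
  (F \in final_run k n j) = (F \in pre_calE k n) && (run F n == j).
Proof. exact: in_fset_sep. Qed.

Lemma pre_calE0 k : pre_calE k 0 = fset0.
Proof.
apply/fsetP => F; rewrite in_fset0; apply/in_pre_calE => -[F0 /(_ _ F0)].
by rewrite leqn0 cardfs_eq0 andbT => /eqP FE; rewrite FE in F0.
Qed.

Lemma pre_calE_run k n (F : {fset nat}) : F \in pre_calE k n -> 1 <= run F n < k.+1.
Proof.
case: n => [|n]; first by rewrite pre_calE0.
by case/in_pre_calE => nF _ Fk /=; rewrite nF /= ltnS Fk.
Qed.

(** An element [m <= 1] together with [n.+2] would give cardinal at least 2, against the Schreier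
    condition. This makes room for translating down by 1. *)
Lemma pre_calE_gt1 {k n} {F : {fset nat}} {m : nat} : F \in pre_calE k n.+2 -> m \in F -> 1 < m.
Proof.
case/in_pre_calE => nF Fn _ mF.
have [//|m1] := ltnP 1 m.
have mn : m != n.+2 by lia.
have : 1 < #|` F|.
  rewrite (cardfsD1 m F) mF (cardfsD1 n.+2 (F `\ m)) !inE nF eq_sym mn; lia.
by have := Fn m mF; lia.
Qed.

(** A forbidden interval starting at [m] is a run of length at least [k] ending at [m + k - 1], so
    bounding the final run like the earlier ones excludes all of them. *)
Lemma calE_pre_calE k n : 1 < k ->
  calE k n = [fset F in pre_calE k n | run F n < k].
Proof.
move=> k1; apply/fsetP => F; rewrite in_fset_sep.
apply/in_calE/andP => [[/fsubsetP Fn nF FS Fk]|[/in_pre_calE[nF Fn Fk] rk]].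
  have Fr i : run F i < k.
    rewrite ltnNge; apply/negP => /leq_runP [ki kF].
    (* The first of the [k] consecutive elements ending at [i]. *)
    have mF : (i - k + 1)%N \in F by apply: kF; lia.
    case/negP: (Fk _ mF); apply/fsubsetP => /= m; rewrite in_interval => mi.
    by apply: kF; lia.
  split=> //; apply/in_pre_calE; split=> // m mF.
  by move/(SchreierP nF): FS => -> //; have := Fn m mF; rewrite in_interval => /andP[].
have F0 : 0 < #|` F| by rewrite cardfs_gt0; apply/fset0Pn; exists n.
split=> //.
- by apply/fsubsetP => /= m mF; rewrite in_interval; have := Fn m mF; lia.
- by apply/(SchreierP nF) => m /Fn/andP[].
move=> m mF; apply/negP => /fsubsetP mk.
have mkF : (m + k - 1)%N \in F by apply: mk; rewrite in_interval; lia.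
have : run F (m + k - 1) < k.
  have [->//|mkn] := eqVneq (m + k - 1) n.
  by apply: Fk; have := Fn _ mkF; lia.
rewrite ltnNge => /negP; apply; apply/leq_runP; have := Fn m mF; split; first lia.
by move=> l lm; apply: mk; rewrite in_interval; lia.
Qed.

(** * Bijections moving the maximum and shortening the final run *)

Lemma card_final_run_next k n : 0 < n -> 0 < k ->
  #|` final_run k n.+1 1| = #|` pre_calE k n|.
Proof.
move=> n0 k0.
pose f F := n |` (F `\ n.+1); pose g G := n.+1 |` (G `\ n).
have run0 F : run F n = 0 -> n \notin F by case: n n0 {f g} => //= n _; case: ifP.
have fK F : n.+1 \in F -> n \notin F -> g (f F) = F.
  move=> nF nF'; apply/fsetP => /= m; rewrite !inE.
  have [->|_] := eqVneq m n.+1; first by rewrite nF.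
  by have [->|] := eqVneq m n; rewrite ?(negPf nF').
have cf F : n.+1 \in F -> n \notin F -> #|` f F| = #|` F|.
  by move=> nF nF'; rewrite cardfsU1 !inE (negPf nF') andbF (cardfsD1 n.+1 F) nF.
have cg G : n \in G -> n.+1 \notin G -> #|` g G| = #|` G|.
  by move=> nG nG'; rewrite cardfsU1 !inE (negPf nG') andbF (cardfsD1 n G) nG.
have FP F : F \in final_run k n.+1 1 ->
    [/\ F \in pre_calE k n.+1, n.+1 \in F & n \notin F].
  rewrite in_final_run /= => /andP[FE]; have /in_pre_calE[nF _ _] := FE.
  by rewrite nF => /eqP[/run0].
have GP G : G \in pre_calE k n -> n \in G /\ n.+1 \notin G.
  case/in_pre_calE => nG Gn _; split=> //; apply/negP => /Gn; lia.
apply: (card_fset_bij f g).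
- move=> F /FP[/in_pre_calE[nF Fn Fk] _ nF']; apply/in_pre_calE; split.
  + by rewrite !inE eqxx.
  + move=> m; rewrite cf // => mf.
    have mn : m <= n.
      move: mf; rewrite !inE => /orP[/eqP->//|/andP[mn /Fn]]; lia.
    rewrite mn andbT; move: mf; rewrite !inE => /orP[/eqP->|/andP[_ /Fn/andP[]//]].
    (* The new element [n] must bound the cardinal: either [F] is the singleton of [n.+1], or
       another element [l <= n] already bounds it. *)
    have [E|] := eqVneq (F `\ n.+1) fset0.
      by rewrite (cardfsD1 n.+1 F) nF E cardfs0.
    by case/fset0Pn => l; rewrite !inE => /andP[ln lF]; have := Fn l lF; lia.
  + move=> i i_n; rewrite (@eq_run _ F) ?Fk //; first lia.
    move=> m mi; have [mn mn1] : m != n /\ m != n.+1 by lia.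
    by rewrite !inE (negPf mn) mn1.
- move=> G GE; have [nG nG'] := GP G GE; case/in_pre_calE: GE => _ Gn Gk.
  have gi i : i < n -> run (g G) i = run G i.
    move=> i_n; apply: eq_run => m mi.
    have [mn mn1] : m != n /\ m != n.+1 by lia.
    by rewrite !inE (negPf mn1) mn.
  have gn : run (g G) n = 0.
    by rewrite run_notin // !inE eqxx orbF ltn_eqF.
  have rg : run (g G) n.+1 == 1 by rewrite run_in ?gn // !inE eqxx.
  rewrite in_final_run rg andbT; apply/in_pre_calE; split.
  + by rewrite !inE eqxx.
  + move=> m; rewrite cg // !inE => /orP[/eqP->|/andP[_ /Gn]]; last lia.
    by have := Gn n nG; lia.
  + move=> i; rewrite ltnS leq_eqVlt => /orP[/eqP->|i_n]; first by rewrite gn.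
    by rewrite gi // Gk.
- by move=> F /FP[_]; apply: fK.
- move=> G /GP[nG nG']; apply/fsetP => /= m; rewrite !inE.
  have [->|_] := eqVneq m n; first by rewrite nG.
  by have [->|] := eqVneq m n.+1; rewrite ?(negPf nG').
Qed.

Lemma card_final_runS k n j : 0 < j < k ->
  #|` final_run k n.+2 j.+1| = #|` final_run k n j|.
Proof.
move=> jk; symmetry.
pose sh G := [fset i.+1 | i in (G : {fset nat})].
have shS G m : (m.+1 \in sh G) = (m \in G).
  by apply/imfsetP/idP => [[i /= iG [->]]//|mG]; exists m.
have sh0 G : 0 \notin sh G by apply/imfsetP => -[].
have shc G : #|` sh G| = #|` G| by apply: card_imfset => ? ? [].
pose f G := n.+2 |` sh G; pose g F := [fset i.-1 | i in (F `\ n.+2 : {fset nat})].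
have fS G m : (m.+1 \in f G) = (m == n.+1) || (m \in G) by rewrite !in_fsetU in_fset1 shS.
(* Since [i.-1] sends both 0 and 1 to 0, [g] is a true translation only when 0 is not in [F]. *)
have gS F m : 0 \notin F -> (m \in g F) = (m.+1 \in F) && (m != n.+1).
  move=> F0; apply/imfsetP/idP => [[[|i] /=]|/andP[mF mn]].
  - by rewrite !inE (negPf F0).
  - by rewrite !inE => /andP[iN iF] ->; rewrite iF.
  - by exists m.+1 => //=; rewrite !inE mF andbT.
have FP F : F \in pre_calE k n.+2 -> 0 \notin F /\ 1 \notin F.
  by move=> FE; split; apply/negP => /(pre_calE_gt1 FE).
have gK F : n.+2 \in F -> 0 \notin F -> f (g F) = F.
  move=> nF F0; apply/fsetP => /= -[|m].
    by rewrite in_fsetU in_fset1 (negPf (sh0 _)) (negPf F0).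
  by rewrite fS gS //; have [->|] := eqVneq m n.+1; rewrite ?nF ?andbT.
have cf G : n.+1 \notin G -> #|` f G| = #|` G|.+1.
  by move=> nG; rewrite cardfsU1 shS nG shc.
have GP G : G \in pre_calE k n -> [/\ n \in G, 0 \notin G & n.+1 \notin G].
  case/in_pre_calE => nG Gn _.
  have G0 : 0 < #|` G| by rewrite cardfs_gt0; apply/fset0Pn; exists n.
  by split=> //; apply/negP => /Gn; lia.
have fr G m : 0 \notin G -> m <= n -> run (f G) m.+1 = run G m.
  move=> G0 mn; apply: run_shift => [|l lm]; first by rewrite fS (negPf G0).
  by rewrite fS (_ : (l == n.+1) = false) //; lia.
have fr2 G : 0 \notin G -> run (f G) n.+2 = (run G n).+1.
  by move=> G0; rewrite run_in ?fr // fS eqxx.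
apply: (card_fset_bij f g).
- move=> G; rewrite in_final_run => /andP[GE /eqP rG]; have [nG G0 nG'] := GP G GE.
  case/in_pre_calE: GE => _ Gn Gk.
  rewrite in_final_run fr2 // rG eqxx andbT.
  apply/in_pre_calE; split; first by rewrite fS eqxx.
    move=> [|m]; first by rewrite in_fsetU in_fset1 (negPf (sh0 _)).
    rewrite fS cf // => /orP[/eqP->|/Gn]; last lia.
    by have := Gn n nG; lia.
  case=> [|i]; first by move=> _ /=; lia.
  (* The run of length [j] now ends at [n.+1], before the maximum, so it has to be shorter than [k]:
     this is where [j < k] enters. *)
  rewrite !ltnS => i_n; rewrite fr //; move: i_n; rewrite leq_eqVlt => /orP[/eqP->|/Gk//].
  by rewrite rG; lia.
- move=> F; rewrite in_final_run => /andP[FE rF]; have [F0 F1] := FP F FE.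
  have /in_pre_calE[nF Fn Fk] := FE.
  have G0 : 0 \notin g F by rewrite gS // (negPf F1).
  have nG : n.+1 \notin g F by rewrite gS // eqxx andbF.
  have cg : #|` F| = #|` g F|.+1 by rewrite -cf // gK.
  have rg : run (g F) n == j by move: rF; rewrite -{1}(gK F) // fr2.
  rewrite in_final_run rg andbT; apply/in_pre_calE; split.
  (* As [0 < j], the run of [g F] at [n] is nonempty, so [n] belongs to [g F]. *)
  + rewrite gS // neq_ltn ltnSn andbT.
    have [] := (leq_runP (g F) n 1).1; first by rewrite (eqP rg); lia.
    by move=> n0 /(_ n); rewrite gS // => /(_ _)/andP[] //; lia.
  + move=> m; rewrite gS // => /andP[mF mn]; have := Fn _ mF; lia.
  + by move=> i i_n; rewrite -fr ?gK //; [apply: Fk; lia|lia].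
- move=> G; rewrite in_final_run => /andP[/GP[nG G0 nG'] _].
  apply/fsetP => /= m; rewrite gS ?fS; last by rewrite in_fsetU in_fset1 (negPf (sh0 _)).
  by have [->|] := eqVneq m n.+1; rewrite ?(negPf nG') ?andbT.
- by move=> F; rewrite in_final_run => /andP[FE _]; apply: gK; [case/in_pre_calE: FE|case: (FP F FE)].
Qed.

Lemma card_final_run k n j : j < k ->
  #|` final_run k n j.+1| = #|` final_run k (n - 2 * j) 1|.
Proof.
have S0 i : final_run k 0 i = fset0.
  by apply/fsetP => F; rewrite in_final_run pre_calE0 in_fset0.
elim: j n => [|j IH] n jk; first by rewrite subn0.
(* For [n] equal to 0 or 1 the truncated index is 0 and the right side is empty; so is the left,
   since no run of length 2 or more ends there. *)
case: n => [|[|n]]; first by rewrite !S0.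
  rewrite (_ : 1 - _ = 0) ?S0; last lia.
  apply/eqP; rewrite cardfs_eq0; apply/eqP/fsetP => F.
  by rewrite in_final_run in_fset0 /=; case: ifP; rewrite andbF.
rewrite card_final_runS // IH; last exact: ltnW.
by congr #|` final_run k _ 1|; lia.
Qed.

Lemma card_pre_calE k n :
  #|` pre_calE k n| = \sum_(0 <= i < k) #|` final_run k (n - 2 * i) 1|.
Proof.
rewrite (card_fset_sum_fibers _ _ (run^~ n) 1 k.+1) => [|F]; last exact: pre_calE_run.
rewrite big_add1 /= !big_nat; apply: eq_bigr => i ik; exact: card_final_run.
Qed.

Lemma card_calE k n : 1 < k ->
  #|` calE k n| = \sum_(0 <= i < k.-1) #|` final_run k (n - 2 * i) 1|.
Proof.
move=> k1; rewrite calE_pre_calE // (card_fset_sum_fibers _ _ (run^~ n) 1 k) => [|F]; last first.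
  by rewrite in_fset_sep => /andP[/pre_calE_run/andP[-> _]].
rewrite big_add1 !big_nat; apply: eq_bigr => i ik.
rewrite -card_final_run; last lia.
congr #|` _|; apply/fsetP => F; rewrite !in_fset_sep.
by case: eqP => [->|]; rewrite ?andbF // !andbT andb_idr //; lia.
Qed.

(** * The recurrence with odd lags *)

(* Since [x 0 = 0], truncated subtraction in [x (n - 2 * i)] has the effect of
   extending [x] by 0 to the negative integers. *)
Definition odd_lag_recurrence (k : nat) (x : nat -> nat) :=
  [/\ x 0 = 0, x 1 = 1 &
      forall n, 0 < n -> x n.+1 = \sum_(0 <= i < k) x (n - 2 * i)].

(** The partial sum is the one that [card_calE] attaches to [calE k n], whose cardinal is thus
    [x n.+1] minus a single term. *)
Lemma recurrence_partial {k x} n : odd_lag_recurrence k x -> 1 < k ->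
  0 < n -> x n.+1 = (\sum_(0 <= i < k.-1) x (n - 2 * i) + x (n - 2 * k.-1))%N.
Proof. by case=> _ _ xS k1 n0; rewrite xS // -{1}(ltn_predK k1) big_nat_recr. Qed.

(** After its first term [x n], the recurrence for [x n.+1] continues as the one for [x (n - 1)]
    without its last term [x (n - 2 * k)]. That term is [x 0 = 0] as long as [n <= 2 * k], which
    leaves the Fibonacci recurrence. *)
Lemma recurrence_fib {k x} n : odd_lag_recurrence k x -> 1 < k ->
  0 < n <= 2 * k -> x n.+1 = fib n.
Proof.
move=> rec k1; have [x0 x1 xS] := rec; elim/ltn_ind: n => -[|[|[|n]]] IH nk; first lia.
- rewrite xS // big_ltn ?(ltnW k1) // subn0 x1 big_nat big1 // => i ik.
  by rewrite (_ : 1 - 2 * i = 0) //; lia.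
- rewrite xS // big_ltn ?(ltnW k1) // subn0 IH //; last lia.
  rewrite big_nat big1 // => i ik.
  by rewrite (_ : 2 - 2 * i = 0) //; lia.
rewrite xS // big_ltn ?(ltnW k1) // subn0 IH; try lia.
rewrite big_add1 (eq_bigr (fun i => x (n.+1 - 2 * i))) => [|i _]; last by congr x; lia.
have := recurrence_partial n.+1 rec k1 isT; rewrite IH; try lia.
by rewrite (_ : n.+1 - 2 * k.-1 = 0) ?x0 ?addn0 => [<-|] //; lia.
Qed.

(** Each [x (n - 2 * i)] is expanded by the recurrence and the two sums are exchanged; [2 * k <= n]
    keeps the index [n - 2 * i] above 1, where the recurrence applies. *)
Lemma recurrence_sum {k x} n : odd_lag_recurrence k x -> 2 * k <= n ->
  \sum_(0 <= i < k.-1) x (n - 2 * i) =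
  \sum_(0 <= j < k) \sum_(0 <= i < k.-1) x (n - 1 - 2 * j - 2 * i).
Proof.
case=> _ _ xS kn; rewrite exchange_big_nat /= !big_nat; apply: eq_bigr => i ik.
rewrite (_ : n - 2 * i = (n - 2 * i).-1.+1) ?xS; try lia.
by apply: eq_bigr => j _; congr x; lia.
Qed.

Theorem theorem1p2 (k : nat) (hk : 2 <= k) :
  (forall n : nat, 1 <= n <= 2 * k - 2 -> #|` calE k n| = fib n) /\
  #|` calE k (2 * k - 1)| = fib (2 * k - 1) - 1 /\
  (forall n : nat, 2 * k <= n ->
     #|` calE k n| = \sum_(1 <= i < k.+1) #|` calE k (n - (2 * i - 1))|).
Proof.
pose x n := #|` final_run k n 1|.
have x0 : x 0 = 0.
  by apply/eqP; rewrite cardfs_eq0; apply/eqP/fsetP => F; rewrite in_final_run pre_calE0 in_fset0.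
have x1 : x 1 = 1.
  apply/eqP/cardfs1P; exists [fset 1]; apply/fsetP => F.
  rewrite in_final_run in_fset1; apply/andP/eqP => [[/in_pre_calE[F1 Fn _] _]|->].
    have F0 : 0 < #|` F| by rewrite cardfs_gt0; apply/fset0Pn; exists 1.
    apply/fsetP => m; rewrite in_fset1; apply/idP/eqP => [/Fn|->//]; lia.
  split; last by rewrite /= in_fset1.
  apply/in_pre_calE; split=> [|m|[|//] _]; first by rewrite in_fset1.
    by rewrite in_fset1 cardfs1 => /eqP->.
  exact: ltnW.
have xS n : 0 < n -> x n.+1 = \sum_(0 <= i < k) x (n - 2 * i).
  by move=> n0; rewrite /x card_final_run_next ?(ltnW hk) // card_pre_calE.
have rec : odd_lag_recurrence k x by split.
have aE n : #|` calE k n| = \sum_(0 <= i < k.-1) x (n - 2 * i) by apply: card_calE.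
split; [|split] => [n nk||n nk].
- have n0 : 0 < n by lia.
  have := recurrence_partial n rec hk n0.
  (* In this range the missing last term is [x 0 = 0]. *)
  rewrite -aE (_ : n - 2 * k.-1 = 0) ?x0 ?addn0; last lia.
  by rewrite (recurrence_fib _ rec hk) => [->|] //; lia.
- have n0 : 0 < 2 * k - 1 by lia.
  have := recurrence_partial _ rec hk n0.
  (* Here the missing last term is [x 1 = 1], the source of the correction by 1. *)
  rewrite -aE (_ : 2 * k - 1 - 2 * k.-1 = 1) ?x1; last lia.
  by rewrite (recurrence_fib _ rec hk) => [->|] //; lia.
rewrite aE (recurrence_sum _ rec) // big_add1 /=; apply: eq_bigr => j _.
by rewrite aE; apply: eq_bigr => i _; congr x; lia.
Qed.
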